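(* Let $I \subseteq \mathbb{R}$ be an open interval (more generally, an open set) and let $\sigma \in \mathbb{P}^{1/2}(I)$. If $\sigma$ is nowhere zero on $I$, then $\sigma^2 \in \mathbb{P}(I)$.
   Context: All functions are real-valued functions of a real variable $t$; dots denote derivatives with respect to $t$. For an open interval (more generally, open set) $I \subseteq \mathbb{R}$, $\mathbb{P}(I)$ denotes the set of all twice-differentiable functions $s : I \to \mathbb{R}$ satisfying on $I$ the (real) fourth Painlevé equation with both parameters zero, $$\ddot{s} = \frac{1}{2s}\dot{s}^2 + \frac{3}{2}s^3 + 4 t s^2 + 2 t^2 s,$$ where at a zero of $s$ the ratio $\dot{s}^2/(2s)$ is understood as a limit. $\mathbb{P}^{1/2}(I)$ denotes the set of all twice-differentiable functions $\sigma : I \to \mathbb{R}$ satisfying on $I$ the auxiliary equation $$4\ddot{\sigma} = \sigma(3\sigma^2 + 2t)(\sigma^2 + 2t).$$ Here $\sigma^2$ is the pointwise square $t \mapsto \sigma(t)^2$. *)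

(* Defs.v *)
From Stdlib Require Import Reals.
From Coquelicot Require Import Coquelicot.
Open Scope R_scope.

(* A function on an open set I is represented by a total function R -> R: every
   notion below, taken at a point of I, depends only on the values on I. *)

Definition twice_differentiable_on (I : R -> Prop) (f : R -> R) : Prop :=
  forall t, I t -> ex_derive f t /\ ex_derive (Derive f) t.

(* "q is the value of s'^2 / (2 s) at t". At a zero t of s it is the limit of
   the quotient at t along the points where the quotient is defined, i.e. where
   s does not vanish (which excludes t itself). If s vanishes on a neighbourhood
   of t, every q qualifies, so that the equation below holds there with q = 0. *)
Definition ratio_value (s : R -> R) (t q : R) : Prop :=
  (s t <> 0 -> q = (Derive s t) ^ 2 / (2 * s t)) /\
  (s t = 0 ->
     filterlim (fun u => (Derive s u) ^ 2 / (2 * s u))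
       (within (fun u => s u <> 0) (locally t)) (locally q)).

Definition PIV (I : R -> Prop) (s : R -> R) : Prop :=
  twice_differentiable_on I s /\
  forall t, I t ->
    exists q, ratio_value s t q /\
      Derive (Derive s) t =
        q + 3 / 2 * (s t) ^ 3 + 4 * t * (s t) ^ 2 + 2 * t ^ 2 * s t.

Definition PIV_half (I : R -> Prop) (sigma : R -> R) : Prop :=
  twice_differentiable_on I sigma /\
  forall t, I t ->
    4 * Derive (Derive sigma) t =
      sigma t * (3 * (sigma t) ^ 2 + 2 * t) * ((sigma t) ^ 2 + 2 * t).

(* Main.v *)
Require Import Defs.
From Stdlib Require Import Reals.
From Coquelicot Require Import Coquelicot.
Open Scope R_scope.

(** Put s = sigma^2. Then s' = 2 sigma sigma' and s'' = 2 sigma'^2 + 2 sigma sigma''. Where sigma is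
    nonzero, the first summand is exactly s'^2 / (2 s), and the auxiliary equation turns the second
    into s (3 s + 2 t)(s + 2 t) / 2, the polynomial part of the fourth Painlevé equation. *)

Lemma is_derive_sqr (f : R -> R) (t : R) :
  ex_derive f t -> is_derive (fun u => f u ^ 2) t (2 * f t * Derive f t).
Proof.
  intros Hf; auto_derive; [exact Hf | ].
  change (Derive (fun x : R => f x) t) with (Derive f t); ring.
Qed.

Lemma is_derive_Derive_sqr (I : R -> Prop) (f : R -> R) (t : R) :
  open I -> twice_differentiable_on I f -> I t ->
  is_derive (Derive (fun u => f u ^ 2)) t
    (2 * Derive f t ^ 2 + 2 * f t * Derive (Derive f) t).
Proof.
  intros hI Hf Ht.
  (* The formula for the first derivative is known only on [I]; openness makes it hold near [t],
     which suffices to differentiate it again. *)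
  apply is_derive_ext_loc with (fun u => 2 * f u * Derive f u).
  - apply (filter_imp I); [ | exact (hI t Ht)].
    intros u Hu; symmetry; apply is_derive_unique, is_derive_sqr, (Hf u Hu).
  - destruct (Hf t Ht) as [H1 H2].
    replace (2 * Derive f t ^ 2 + 2 * f t * Derive (Derive f) t)
      with (2 * Derive f t * Derive f t + 2 * f t * Derive (Derive f) t) by ring.
    apply (is_derive_mult (fun u => 2 * f u) (Derive f)).
    + apply (is_derive_scal f), Derive_correct, H1.
    + apply Derive_correct, H2.
    + intros; apply Rmult_comm.
Qed.

Theorem theorem2 (I : R -> Prop) (hI : open I) (sigma : R -> R)
  (hsigma : PIV_half I sigma) (hnz : forall t, I t -> sigma t <> 0) :
  PIV I (fun t => (sigma t) ^ 2).
Proof.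
  destruct hsigma as [Hd Heq]; split; intros t Ht;
    pose proof (is_derive_sqr sigma t (proj1 (Hd t Ht))) as D1;
    pose proof (is_derive_Derive_sqr I sigma t hI Hd Ht) as D2.
  - split; eexists; [exact D1 | exact D2].
  (* The witness is (2 sigma sigma')^2 / (2 sigma^2) after cancelling sigma^2. *)
  - exists (2 * Derive sigma t ^ 2); repeat split.
    + intros _.
      replace (Derive (fun u => sigma u ^ 2) t) with (2 * sigma t * Derive sigma t)
        by (symmetry; exact (is_derive_unique _ _ _ D1)).
      field; exact (hnz t Ht).
    (* The limit clause is vacuous, since sigma^2 has no zero on [I]. *)
    + intros H0; exfalso; exact (pow_nonzero _ 2 (hnz t Ht) H0).
    + replace (Derive (Derive (fun u => sigma u ^ 2)) t)
        with (2 * Derive sigma t ^ 2 + 2 * sigma t * Derive (Derive sigma) t)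
        by (symmetry; exact (is_derive_unique _ _ _ D2)).
      (* With sigma'' eliminated, the terms 2 sigma'^2 cancel and expanding (3 s + 2 t)(s + 2 t) = 3
         s^2 + 8 t s + 4 t^2 gives the claim. *)
      replace (Derive (Derive sigma) t) with
        (sigma t * (3 * sigma t ^ 2 + 2 * t) * (sigma t ^ 2 + 2 * t) / 4)
        by (rewrite <- (Heq t Ht); field).
      field.
Qed.
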